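(* Let $m\ge 1$ be an integer and let $F,G$ be cumulative distribution functions on $\mathbb{R}$ with finite mean. Then for every $p\in[1,\infty)$, $$\|\mathcal H_m(F)-\mathcal H_m(G)\|_p^p\le \|F-G\|_1,$$ where $\mathcal H_m$ is the Hoeffding CDF operator and the norms are those of $L^p(\mathbb{R})$ and $L^1(\mathbb{R})$ with respect to Lebesgue measure.
   Context: For a CDF $G$, $G^{-1}(u)=\inf\{x:G(x)\ge u\}$ is its quantile function. For integers $1\le j\le m$, $F_{B_{j:m}}$ and $f_{B_{j:m}}$ denote the CDF and density of the Beta$(j,m-j+1)$ distribution on $[0,1]$. For a CDF $G$ with finite mean put $\mu_{j:m}(G)=\int_0^1 G^{-1}(u)\,dF_{B_{j:m}}(u)=\int_0^1 G^{-1}(u) f_{B_{j:m}}(u)\,du$, the expected $j$-th order statistic of an iid sample of size $m$ from $G$. The Hoeffding CDF operator is $\mathcal H_m(G)(x)=\frac1m\sum_{j=1}^m \mathbf 1\{\mu_{j:m}(G)\le x\}$, $x\in\mathbb{R}$. *)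

(* Defs.v *)
From HB Require Import structures.
From mathcomp Require Import all_boot all_order all_algebra.
From mathcomp Require Import all_classical all_reals all_analysis.

Set Implicit Arguments.
Unset Strict Implicit.
Unset Printing Implicit Defensive.

Import Order.TTheory GRing.Theory Num.Theory.
Import numFieldNormedType.Exports.

Local Open Scope classical_set_scope.
Local Open Scope ring_scope.

Definition finite_mean {R : realType} (G : cumulativeBounded (0 : R) (1 : R)) : Prop :=
  (lebesgue_stieltjes_measure G).-integrable [set: R] (EFin \o @idfun R).

(* The infimum is taken in the extended reals because it can be infinite at
   u = 0 and u = 1; it is finite for 0 < u < 1. *)
Definition quantile {R : realType} (G : R -> R) (u : R) : \bar R :=
  ereal_inf [set x%:E | x in [set x : R | u <= G x]].

(* Extended-real valued only because [quantile] is; it is finite whenever G is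
   a CDF with finite mean. *)
Definition mu_os {R : realType} (j m : nat) (G : R -> R) : \bar R :=
  (\int[lebesgue_measure]_(u in `[0%R, 1%R])
     (quantile G u * (beta_pdf j (m - j + 1)%N u)%:E))%E.

Definition hoeffding {R : realType} (m : nat) (G : R -> R) (x : R) : R :=
  m%:R^-1 * \sum_(1 <= j < m.+1) \1_[set y : R | (mu_os j m G <= y%:E)%E] x.

(* Main.v *)
(** For 0 < u < 1, the quantile of F satisfies the Galois connection
    [F^-1(u) <= x <-> u <= F x].  Writing |a - b| as the integral over x of
    |1{a <= x} - 1{b <= x}| and applying Tonelli, the connection turns
    the integral of |F^-1 - G^-1| over ]0, 1[ into the integral of |F - G|.
    Comparing F with the step function at 0 in the same way shows that F^-1 is
    integrable when F has a finite mean, so that the [mu_os j m F] are finite.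

    The integrand |H_m(F) - H_m(G)| has values in [0, 1], so its p-th power is
    at most itself, and its integral is at most the mean over j of
    |mu_{j:m}(F) - mu_{j:m}(G)|, hence at most the integral of
    |F^-1 - G^-1| times the mean of the Beta(j, m - j + 1) densities.  By the
    binomial theorem this mean is 1 on [0, 1]. *)
Require Import Defs.
From HB Require Import structures.
From mathcomp Require Import all_boot all_order all_algebra.
From mathcomp Require Import all_classical all_reals all_analysis.
From mathcomp Require Import measurable_realfun ring lra.

Set Implicit Arguments.
Unset Strict Implicit.
Unset Printing Implicit Defensive.

Import Order.TTheory GRing.Theory Num.Theory.
Import numFieldNormedType.Exports.

Local Open Scope classical_set_scope.
Local Open Scope ring_scope.

(** * Absolute differences as integrals of step functions *)

Lemma integral_dist_ge_step (R : realType) (a b : R) :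
  (\int[lebesgue_measure]_x `|(a <= x)%R%:R - (b <= x)%R%:R : R|%R%:E =
   `|a - b|%R%:E)%E.
Proof.
wlog ab : a b / a <= b.
  move=> h; have [/h//|/ltW /h ba] := leP a b.
  rewrite distrC -ba; apply: eq_integral => x _; congr EFin.
  by rewrite distrC.
transitivity (\int[lebesgue_measure]_x (\1_`[a, b[ x : R)%:E)%E.
  apply: eq_integral => x _; congr EFin.
  rewrite indicE mem_setE in_itv/= ltNge.
  have [bx|_] := leP b x; first by rewrite (le_trans ab bx) subrr normr0.
  by rewrite subr0 andbT normr_nat.
rewrite integral_indic// setIT/= lebesgue_measure_itv/= lte_fin ler0_norm ?subr_le0//.
by rewrite opprB; case: ltgtP ab => // -> _; rewrite subrr.
Qed.

(** Mirror form for integrating over the level [u], with thresholds such as [F x] and [G x]; the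
    previous form integrates over [x]. *)
Lemma integral_dist_le_step (R : realType) (a b : R) :
  (\int[lebesgue_measure]_x `|(x <= a)%R%:R - (x <= b)%R%:R : R|%R%:E =
   `|a - b|%R%:E)%E.
Proof.
wlog ab : a b / a <= b.
  move=> h; have [/h//|/ltW /h ba] := leP a b.
  rewrite distrC -ba; apply: eq_integral => x _; congr EFin.
  by rewrite distrC.
transitivity (\int[lebesgue_measure]_x (\1_`]a, b] x : R)%:E)%E.
  apply: eq_integral => x _; congr EFin.
  rewrite indicE mem_setE in_itv/=.
  have [xa|_] := leP x a; first by rewrite (le_trans xa ab) subrr normr0.
  by rewrite sub0r normrN normr_nat.
rewrite integral_indic// setIT/= lebesgue_measure_itv/= lte_fin ler0_norm ?subr_le0//.
by rewrite opprB; case: ltgtP ab => // -> _; rewrite subrr.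
Qed.

Lemma measurable_step (d : measure_display) (T : measurableType d) (R : realType)
    (f g : T -> R) : measurable_fun [set: T] f -> measurable_fun [set: T] g ->
  measurable_fun [set: T] (fun t => (f t <= g t)%R%:R : R).
Proof.
move=> mf mg.
rewrite (_ : (fun _ => _) = \1_[set t | f t <= g t]).
  apply: measurable_indic; rewrite -[X in measurable X]setTI.
  exact: measurable_fun_le.
by apply/funext => t; rewrite indicE mem_setE.
Qed.

Section layer_cake.
Variables (d : measure_display) (T : measurableType d) (R : realType).
Variables (mu : {sigma_finite_measure set T -> \bar R}) (f g : T -> R).
Hypotheses (mf : measurable_fun [set: T] f) (mg : measurable_fun [set: T] g).

Let h (z : T * R) := `|(f z.1 <= z.2)%R%:R - (g z.1 <= z.2)%R%:R : R|%R%:E.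

Let mh : measurable_fun [set: T * R] h.
Proof.
apply/measurable_EFinP/measurableT_comp => //; apply: measurable_funB.
  by apply: measurable_step => //; exact: measurableT_comp.
by apply: measurable_step => //; exact: measurableT_comp.
Qed.

Let h0 z : (0 <= h z)%E. Proof. by rewrite lee_fin. Qed.

Lemma measurable_integral_dist_step :
  measurable_fun [set: R]
    (fun x => \int[mu]_t `|(f t <= x)%R%:R - (g t <= x)%R%:R : R|%R%:E)%E.
Proof. exact: (@measurable_fun_fubini_tonelli_G _ _ _ _ _ mu h). Qed.

(** Tonelli applied to [integral_dist_ge_step]. The measure stays general because it is taken to be
    Lebesgue measure for quantiles and the Stieltjes measure of [F] for its mean. *)
Lemma integral_dist_layer_cake :
  (\int[mu]_t `|f t - g t|%R%:E =
   \int[lebesgue_measure]_x \int[mu]_t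
     `|(f t <= x)%R%:R - (g t <= x)%R%:R : R|%R%:E)%E.
Proof.
transitivity (\int[mu]_t \int[lebesgue_measure]_x h (t, x))%E.
  by apply: eq_integral => t _; rewrite -integral_dist_ge_step.
exact: (@fubini_tonelli _ _ _ _ _ mu lebesgue_measure h).
Qed.

End layer_cake.

(** * Real-valued quantile functions *)

Section quantile.
Variables (R : realType) (F : cumulativeBounded (0 : R) (1 : R)).

(** The limits 0 and 1 of [F] at the infinities make the superlevel set [S] bounded below and
    nonempty; right continuity puts its infimum in [S]. *)
Lemma quantile_galois (u : R) : u \in `]0, 1[ ->
  exists r : R, quantile F u = r%:E /\ forall x, (r <= x) = (u <= F x).
Proof.
rewrite in_itv/= => /andP[u0 u1].
have Fnd : {homo (F : R -> R) : x y / x <= y} := cumulative_is_nondecreasing F.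
pose S := [set x : R | u <= F x].
have S0 : S !=set0.
  have : \forall x \near +oo, u < F x by exact: (cvgr_gt 1 (cumulativey F) u u1).
  case=> M [_ h]; exists (M + 1) => /=; apply/ltW/h; lra.
have [l Fl] : exists l, F l < u.
  have : \forall x \near -oo, F x < u by exact: (cvgr_lt 0 (cumulativeNy F) u u0).
  case=> M [_ h]; exists (M - 1) => /=; apply/h; lra.
have lbS : lbound S l.
  move=> x /= ux; rewrite leNgt; apply/negP => /ltW /Fnd xl.
  by have := le_lt_trans (le_trans ux xl) Fl; rewrite ltxx.
have hS : has_inf S by split => //; exists l.
exists (inf S); split.
  by rewrite /quantile -/S ereal_inf_EFin//; case: hS.
move=> x; apply/idP/idP; last by move=> ux; apply: ge_inf => //; exists l.
move=> /Fnd; apply: le_trans; rewrite leNgt; apply/negP => Fu.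
(* With half the gap as tolerance, [F] stays below [u] slightly to the right of [inf S], yet points
   of [S] lie there. *)
have e0 : 0 < (u - F (inf S)) / 2 by lra.
have [d hd] := nondecreasing_right_continuousP (inf S) F e0.
have d0 : 0 < d%:num by [].
have [s us sd] := inf_adherent d0 hS.
have : u <= F (inf S) + (u - F (inf S)) / 2.
  exact: le_trans us (le_trans (Fnd _ _ (ltW sd)) hd).
by move: Fu; move: (F (inf S)) => y; lra.
Qed.

(** The value 0 off ]0, 1[ avoids the possibly infinite endpoint values and lets all integrals run
    over the whole line. *)
Definition rquantile (u : R) : R :=
  if u \in `]0, 1[ then fine (quantile F u) else 0.

Lemma rquantile_le (u x : R) : u \in `]0, 1[ ->
  (rquantile u <= x) = (u <= F x).
Proof.
by move=> u01; rewrite /rquantile u01; have [r [-> /(_ x)]] := quantile_galois u01.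
Qed.

Lemma rquantileE (u : R) : u \in `]0, 1[ -> quantile F u = (rquantile u)%:E.
Proof.
by move=> u01; rewrite /rquantile u01; have [r [-> _]] := quantile_galois u01.
Qed.

Lemma rquantile_out (u : R) : u \notin `]0, 1[ -> rquantile u = 0.
Proof. by rewrite /rquantile => /negbTE ->. Qed.

(** The Galois connection makes [rquantile] monotone on ]0, 1[, so the preimages there of the
    generating rays [r, +oo[ are intervals. *)
Lemma measurable_rquantile : measurable_fun [set: R] rquantile.
Proof.
rewrite (_ : rquantile = rquantile \_ `]0, 1[); last first.
  by apply/funext => u; rewrite patchE mem_setE; case: ifPn => // /rquantile_out.
apply/(measurable_restrictT _ _).1 => //.
apply: (measurability (@RGenCInfty.G R)) => [|/= _ [_] [r] -> <-].
  exact: RGenCInfty.measurableE.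
apply: is_interval_measurable => s t/=.
rewrite !in_itv/= !andbT => -[/andP[s0 s1] rs] [/andP[t0 t1] rt] u /andP[su ut].
have u01 : u \in `]0, 1[ by rewrite in_itv/= (lt_le_trans s0 su) (le_lt_trans ut t1).
split; first by rewrite in_itv in u01.
rewrite /= in_itv/= andbT (le_trans rs)// rquantile_le ?in_itv/= ?s0 ?s1//.
by rewrite (le_trans su)// -rquantile_le.
Qed.

End quantile.

(** * Comparison of L1 distances of quantile functions and of CDFs *)

Lemma integral_dist_step_le (R : realType) (f g : R -> R) (a b x : R) :
  measurable_fun [set: R] f -> measurable_fun [set: R] g ->
  {in `]0, 1[, forall u, (f u <= x) = (u <= a)} ->
  {in `]0, 1[, forall u, (g u <= x) = (u <= b)} ->
  (forall u, u \notin `]0, 1[ -> f u = g u) ->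
  (\int[lebesgue_measure]_u `|(f u <= x)%R%:R - (g u <= x)%R%:R : R|%R%:E <=
   `|a - b|%R%:E)%E.
Proof.
move=> mf mg fa gb fg; rewrite -integral_dist_le_step.
apply: ge0_le_integral => //=.
- apply/measurable_EFinP/measurableT_comp => //.
  by apply: measurable_funB; apply: measurable_step.
- apply/measurable_EFinP/measurableT_comp => //.
  by apply: measurable_funB; apply: measurable_step.
(* The two integrands agree on ]0, 1[, and the left one vanishes elsewhere. *)
- move=> u _; rewrite lee_fin; have [u01|u01] := boolP (u \in `]0, 1[).
    by rewrite fa// gb.
  by rewrite fg// subrr normr0.
Qed.

Lemma lebesgue_stieltjes_itvNyc (R : realType) (F : cumulativeBounded (0 : R) (1 : R))
    (x : R) : lebesgue_stieltjes_measure F `]-oo, x] = (F x)%:E.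
Proof.
by rewrite -cdf_lebesgue_stieltjes_id /cdf /distribution /pushforward preimage_id.
Qed.

Lemma lebesgue_stieltjes_itvoy (R : realType) (F : cumulativeBounded (0 : R) (1 : R))
    (x : R) : lebesgue_stieltjes_measure F `]x, +oo[ = (1 - F x)%:E.
Proof.
rewrite -setCitvl probability_setC//.
by rewrite EFinB; congr (_ - _)%E; exact: lebesgue_stieltjes_itvNyc.
Qed.

(** The integrand is the indicator of ]x, +oo[ when 0 <= x and of ]-oo, x] when x < 0. *)
Lemma integral_stieltjes_dist_step (R : realType)
    (F : cumulativeBounded (0 : R) (1 : R)) (x : R) :
  (\int[lebesgue_stieltjes_measure F]_y
     `|(y <= x)%R%:R - (0 <= x)%R%:R : R|%R%:E =
   `|F x - (0 <= x)%R%:R|%R%:E)%E.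
Proof.
have F0 : (0 <= (F x)%:E)%E by rewrite -lebesgue_stieltjes_itvNyc.
have F1 : (0 <= (1 - F x)%:E)%E by rewrite -lebesgue_stieltjes_itvoy.
rewrite !lee_fin in F0 F1.
have [x0|x0] := leP 0 x.
- rewrite distrC ger0_norm// -lebesgue_stieltjes_itvoy -[X in _ = _ X]setIT.
  rewrite -integral_indic//; apply: eq_integral => y _; congr EFin.
  rewrite indicE mem_setE in_itv/= andbT ltNge.
  by case: leP => _; rewrite ?subrr ?normr0// sub0r normrN normr1.
- rewrite subr0 ger0_norm// -lebesgue_stieltjes_itvNyc -[X in _ = _ X]setIT.
  rewrite -integral_indic//; apply: eq_integral => y _; congr EFin.
  by rewrite indicE mem_setE in_itv/= subr0 normr_nat.
Qed.

(** Layer cake for the identity against the constant 0: the first absolute moment is the L1 distance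
    from [F] to the CDF of the point mass at 0. *)
Lemma integral_stieltjes_normr (R : realType) (F : cumulativeBounded (0 : R) (1 : R)) :
  (\int[lebesgue_stieltjes_measure F]_y `|(EFin \o idfun) y| =
   \int[lebesgue_measure]_x `|F x - (0 <= x)%R%:R|%R%:E)%E.
Proof.
have mid : measurable_fun [set: measurableTypeR R] (idfun : _ -> R).
  exact: measurable_id.
under [RHS]eq_integral do rewrite -integral_stieltjes_dist_step.
apply: etrans (integral_dist_layer_cake
  (lebesgue_stieltjes_measure F) mid (measurable_cst _)).
by apply: eq_integral => y _; rewrite /= subr0.
Qed.

Lemma measurable_cumulative (R : realType) (F : cumulativeBounded (0 : R) (1 : R)) :
  measurable_fun [set: R] F.
Proof.
by apply: nondecreasing_measurable => //; exact: cumulative_is_nondecreasing.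
Qed.

Lemma integrable_rquantile (R : realType) (F : cumulativeBounded (0 : R) (1 : R)) :
  finite_mean F -> lebesgue_measure.-integrable [set: R] (EFin \o rquantile F).
Proof.
have mq := measurable_rquantile F.
move=> /integrableP[_ Foo]; apply/integrableP; split.
  exact/measurable_EFinP.
apply: le_lt_trans Foo.
rewrite [leRHS]integral_stieltjes_normr.
have -> : (\int[lebesgue_measure]_u `|(EFin \o rquantile F) u| =
    \int[lebesgue_measure]_x \int[lebesgue_measure]_u
      `|(rquantile F u <= x)%R%:R - (0 <= x)%R%:R : R|%R%:E)%E.
  apply: etrans (integral_dist_layer_cake lebesgue_measure mq (measurable_cst _)).
  by apply: eq_integral => u _; rewrite /= subr0.
apply: ge0_le_integral => //.
- by move=> x _; apply: integral_ge0 => u _; rewrite lee_fin.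
- exact: (measurable_integral_dist_step lebesgue_measure mq (measurable_cst _)).
- apply/measurable_EFinP/measurableT_comp => //; apply: measurable_funB.
    exact: measurable_cumulative.
  exact: measurable_step.
- move=> x _; apply: integral_dist_step_le => //.
  + by move=> u u01; rewrite rquantile_le.
  (* The constant 0 is the quantile function of the step at 0: a level in ]0, 1[ is at most 1 but
     not at most 0. *)
  + move=> u; rewrite in_itv/= => /andP[u0 u1].
    by case: (0 <= x) => /=; [rewrite ltW|rewrite leNgt u0].
  + by move=> u /rquantile_out.
Qed.

Lemma integral_dist_rquantile (R : realType) (F G : cumulativeBounded (0 : R) (1 : R)) :
  (\int[lebesgue_measure]_u `|rquantile F u - rquantile G u|%R%:E <=
   \int[lebesgue_measure]_x `|F x - G x|%R%:E)%E.
Proof.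
have mq H := @measurable_rquantile R H.
rewrite (integral_dist_layer_cake lebesgue_measure (mq F) (mq G)).
apply: ge0_le_integral => //.
- by move=> x _; apply: integral_ge0 => u _; rewrite lee_fin.
- exact: (measurable_integral_dist_step lebesgue_measure (mq F) (mq G)).
- apply/measurable_EFinP/measurableT_comp => //.
  by apply: measurable_funB; exact: measurable_cumulative.
- move=> x _; apply: integral_dist_step_le => //.
  + by move=> u u01; rewrite rquantile_le.
  + by move=> u u01; rewrite rquantile_le.
  + by move=> u u01; rewrite !rquantile_out.
Qed.

(** * Beta weights and means of order statistics *)

Lemma sum_beta_pdf_le (R : realType) (m : nat) (u : R) :
  \sum_(1 <= j < m.+1) beta_pdf j (m - j + 1) u <= m%:R.
Proof.
case: m => [|n]; first by rewrite big_geq.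
have [u01|u01] := boolP (u \in `[0, 1]%classic); last first.
  by rewrite big1// => j _; rewrite /beta_pdf patchE (negbTE u01) mul0r.
rewrite big_add1/= big_mkord.
(* After the shift of [j] by one, the Beta(j + 1, n - j + 1) density is n + 1 times the j-th term of
   the expansion of ((1 - u) + u)^n. *)
rewrite (eq_bigr (fun j : 'I_n.+1 =>
    n.+1%:R * ((1 - u) ^+ (n - j) * u ^+ j *+ 'C(n, j)))).
  by rewrite -mulr_sumr -exprDn subrK expr1n mulr1.
move=> [j /= jn] _; rewrite subSS addn1 /beta_pdf patchE u01 beta_fun_fact/=.
rewrite subnKC// -mulr_natr /XMonemX.
have -> : n.+1`! = (n.+1 * ('C(n, j) * (j`! * (n - j)`!)))%N.
  by rewrite bin_fact.
rewrite !natrM.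
have : (j`!%:R : R) != 0 by rewrite pnatr_eq0 -lt0n fact_gt0.
have : ((n - j)`!%:R : R) != 0 by rewrite pnatr_eq0 -lt0n fact_gt0.
by move=> h1 h2; field; rewrite h1 h2 nat1r !pnatr_eq0 -lt0n bin_gt0 -ltnS jn.
Qed.

(** The density is bounded by [(beta_fun a b)^-1], so a multiple of [rquantile F] dominates the
    product. *)
Lemma integrable_rquantile_beta (R : realType) (F : cumulativeBounded (0 : R) (1 : R))
    (a b : nat) : finite_mean F ->
  lebesgue_measure.-integrable [set: R]
    (EFin \o (fun u => rquantile F u * beta_pdf a b u)).
Proof.
move=> /integrable_rquantile iF.
apply: (le_integrable measurableT _ _ (integrableZl measurableT (beta_fun a b)^-1 iF)).
  apply/measurable_EFinP/measurable_funM; first exact: measurable_rquantile.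
  exact: measurable_beta_pdf.
move=> u _ /=; rewrite lee_fin normrM mulrC [leRHS]normrM ler_wpM2r//.
rewrite !ger0_norm ?beta_pdf_ge0 ?invr_ge0 ?beta_fun_ge0//.
exact: beta_pdf_le_beta_funV.
Qed.

(** The endpoints, where the two quantiles may differ, form a null set. *)
Lemma mu_osE (R : realType) (F : cumulativeBounded (0 : R) (1 : R)) (j m : nat) :
  mu_os j m F =
  (\int[lebesgue_measure]_u (rquantile F u * beta_pdf j (m - j + 1) u)%R%:E)%E.
Proof.
have qE : {in `]0, 1[%classic, (fun u => (rquantile F u * beta_pdf j (m - j + 1) u)%R%:E)
    =1 (fun u => quantile F u * (beta_pdf j (m - j + 1) u)%:E)%E}.
  by move=> u; rewrite inE/= => u01; rewrite rquantileE.
rewrite /mu_os integral_itv_bndoo; last first.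
  apply: eq_measurable_fun qE _; apply/measurable_funTS/measurable_EFinP.
  by apply: measurable_funM; [exact: measurable_rquantile|exact: measurable_beta_pdf].
transitivity (\int[lebesgue_measure]_(u in `]0%R, 1%R[)
    (rquantile F u * beta_pdf j (m - j + 1) u)%R%:E)%E.
  by apply: eq_integral => u u01; rewrite -qE.
rewrite integral_mkcond.
apply: eq_integral => u _; rewrite patchE; case: ifPn => //.
by rewrite mem_setE => u01; rewrite rquantile_out// mul0r.
Qed.

(** Integrability makes each [mu_os j m F] finite, so [fine] preserves the comparison with [x]. *)
Lemma hoeffdingE (R : realType) (m : nat) (F : cumulativeBounded (0 : R) (1 : R)) (x : R) :
  finite_mean F ->
  hoeffding m F x = m%:R^-1 * \sum_(1 <= j < m.+1) (fine (mu_os j m F) <= x)%R%:R.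
Proof.
move=> hF; rewrite /hoeffding; congr (_ * _); apply: eq_bigr => j _.
rewrite indicE mem_setE; congr (_%:R : R); congr nat_of_bool.
rewrite -lee_fin fineK// mu_osE.
by apply: integrable_fin_num => //; exact: integrable_rquantile_beta.
Qed.

Lemma measurable_hoeffding (R : realType) (m : nat) (F : cumulativeBounded (0 : R) (1 : R)) :
  finite_mean F -> measurable_fun [set: R] (hoeffding m F).
Proof.
move=> hF; rewrite (_ : hoeffding m F = fun x =>
  m%:R^-1 * \sum_(1 <= j < m.+1) (fine (mu_os j m F) <= x)%R%:R); last first.
  by apply/funext => x; rewrite hoeffdingE.
apply: measurable_funM => //; apply: measurable_sum => j.
exact: measurable_step.
Qed.

Lemma le_dist_mu_os (R : realType) (F G : cumulativeBounded (0 : R) (1 : R)) (j m : nat) :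
  finite_mean F -> finite_mean G ->
  (`|fine (mu_os j m F) - fine (mu_os j m G)|%R%:E <=
   \int[lebesgue_measure]_u
     (`|rquantile F u - rquantile G u| * beta_pdf j (m - j + 1) u)%R%:E)%E.
Proof.
move=> hF hG; rewrite !mu_osE.
have iF := integrable_rquantile_beta j (m - j + 1) hF.
have iG := integrable_rquantile_beta j (m - j + 1) hG.
rewrite -abse_EFin EFinB !fineK ?integrable_fin_num//.
rewrite -integralB_EFin//.
apply: le_trans (le_abse_integral _ _ _) _ => //.
  by apply: emeasurable_funB; [case/integrableP: iF|case/integrableP: iG].
rewrite le_eqVlt; apply/orP; left; apply/eqP/eq_integral => u _.
rewrite -EFinB abse_EFin -mulrBl normrM; congr (_ * _)%:E.
by rewrite ger0_norm// beta_pdf_ge0.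
Qed.

Theorem theorem1 (R : realType) (m : nat) (hm : (1 <= m)%N)
    (F G : cumulativeBounded (0 : R) (1 : R))
    (hF : finite_mean F) (hG : finite_mean G) (p : R) (hp : 1 <= p) :
  ('N[lebesgue_measure]_(p%:E)[EFin \o (hoeffding m F \- hoeffding m G)%R] `^ p
   <= 'N[lebesgue_measure]_1[EFin \o (F \- G)%R])%E.
Proof.
have p0 : p != 0 by lra.
have m0 : 0 <= m%:R^-1 :> R by rewrite invr_ge0.
rewrite poweR_Lnorm// Lnorm1.
pose c (H : R -> R) j : R := fine (mu_os j m H).
pose s j x : R := `|(c F j <= x)%R%:R - (c G j <= x)%R%:R : R|.
have ms j : measurable_fun [set: R] (s j).
  by apply: measurableT_comp => //; apply: measurable_funB; exact: measurable_step.
have mEs j : measurable_fun [set: R] (fun x => (s j x)%:E).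
  by apply/measurable_EFinP; exact: ms.
have s0 j x : (0 <= (s j x)%:E)%E by rewrite lee_fin /s.
have mb j := @measurable_beta_pdf R j (m - j + 1).
have mq H := @measurable_rquantile R H.
have mqB : measurable_fun [set: R] (fun u => `|rquantile F u - rquantile G u|).
  by apply: measurableT_comp => //; exact: measurable_funB.
pose w j u : R := `|rquantile F u - rquantile G u| * beta_pdf j (m - j + 1) u.
have mEw j : measurable_fun [set: R] (fun u => (w j u)%:E).
  exact/measurable_EFinP/measurable_funM.
have w0 j u : (0 <= (w j u)%:E)%E by rewrite lee_fin mulr_ge0// beta_pdf_ge0.
have sum_s x : `|hoeffding m F x - hoeffding m G x| <=
    m%:R^-1 * \sum_(1 <= j < m.+1) s j x.
  rewrite !hoeffdingE// -mulrBr -sumrB normrM (ger0_norm m0) ler_wpM2l//.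
  exact: ler_norm_sum.
(* Each [s j x] is 0 or 1; this bound is what allows the exponent [p] to be dropped. *)
have sum1 x : m%:R^-1 * \sum_(1 <= j < m.+1) s j x <= 1.
  rewrite mulrC ler_pdivrMr ?ltr0n// mul1r.
  apply: (@le_trans _ _ (\sum_(1 <= j < m.+1) 1)).
    apply: ler_sum => j _; rewrite /s.
    by case: (_ <= x); case: (_ <= x);
      rewrite ?subrr ?subr0 ?sub0r ?normrN ?normr1 ?normr0.
  by rewrite big_const_nat iter_addr addr0 subn1.
apply: (@le_trans _ _ (\int[lebesgue_measure]_x
    (m%:R^-1%:E * \sum_(1 <= j < m.+1) (s j x)%:E))%E).
  apply: ge0_le_integral => //.
  - by move=> x _; exact: poweR_ge0.
  - apply/(measurableT_comp (measurable_poweR p))/measurableT_comp => //.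
    by apply/measurable_EFinP/measurable_funB; exact: measurable_hoeffding.
  - by apply: emeasurable_funM => //; exact: emeasurable_sum.
  - move=> x _ /=; rewrite sumEFin -EFinM lee_fin.
    apply: le_trans (sum_s x).
    (* The comparison of a power with its base is applied on ]0, 1], so 0 is treated apart. *)
    have [->|d0] := eqVneq (hoeffding m F x - hoeffding m G x) 0.
      by rewrite normr0 powR0.
    apply: ge1r_powR => //.
    by rewrite normr_gt0 d0 (le_trans (sum_s x) (sum1 x)).
rewrite ge0_integralZl_EFin//; last 2 first.
- by move=> x _; exact: sume_ge0.
- exact: emeasurable_sum.
rewrite ge0_integral_sum//.
apply: (@le_trans _ _ (m%:R^-1%:E *
    \sum_(1 <= j < m.+1) \int[lebesgue_measure]_u (w j u)%:E)%E).
  rewrite lee_wpmul2l ?lee_fin//; apply: lee_sum => j _.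
  by rewrite integral_dist_ge_step; exact: le_dist_mu_os.
(* The sum goes back under the integral because a single Beta density may exceed 1; only their mean
   is bounded by 1. *)
rewrite -ge0_integral_sum// -ge0_integralZl_EFin//; last 2 first.
- by move=> u _; exact: sume_ge0.
- exact: emeasurable_sum.
apply: le_trans (integral_dist_rquantile F G).
apply: ge0_le_integral => //.
- by move=> u _; apply: mule_ge0; [rewrite lee_fin|exact: sume_ge0].
- by apply: emeasurable_funM => //; exact: emeasurable_sum.
- exact/measurable_EFinP.
- move=> u _; rewrite sumEFin -EFinM lee_fin -mulr_sumr mulrCA ler_piMr//.
  by rewrite mulrC ler_pdivrMr ?ltr0n// mul1r sum_beta_pdf_le.
Qed.
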